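(* Let $G$ be a finite $\partial$-graph. The following are equivalent: \begin{enumerate} \item $G$ is layerable. \item For every commutative ring $R$, every $R^\times$-network on $G$ is non-degenerate. \item For every commutative ring $R$ and every non-degenerate $R^\times$-network $(G,L)$ on the $\partial$-graph $G$, $\Upsilon(G,L)$ is a free $R$-module. \item There exists a field $F$ with at least three elements such that $\Upsilon(G,L^*(G,F))$ is a flat $R^*(G,F)$-module. \item There exists a field $F$ with at least three elements such that every $F^\times$-network on $G$ is non-degenerate. \end{enumerate}
   Context: Graphs are undirected multigraphs with vertex set $V$ and set $E$ of oriented edges (each undirected edge gives $e$ and its reverse $\overline{e}$); $e_+$, $e_-$ are the starting and ending vertices of $e$; $\mathcal{E}(x)=\{e: e_+=x\}$. A $\partial$-graph is a graph with a partition $V=V^\circ\sqcup\partial V$ (interior and boundary vertices). For a commutative ring $R$, a generalized Laplacian is an $R$-linear map $L:RV\to RV$, $Lx=d(x)x+\sum_{e\in\mathcal{E}(x)}w(e)(x-e_-)$, with $w:E\to R$, $w(\overline{e})=w(e)$, and $d:V\to R$ arbitrary. An $R$-network is a pair $(G,L)$; it is an $R^\times$-network if $w(e)\in R^\times$ for all $e$ (no condition on $d$). For $u:V\to M$, $Lu(x)=d(x)u(x)+\sum_{e\in\mathcal{E}(x)}w(e)(u(x)-u(e_-))$. $\Upsilon(G,L)=RV/L(RV^\circ)$. $\mathcal{U}_0(G,L,M)$ is the module of finitely supported $u:V\to M$ with $Lu\equiv0$ on $V$ and $u|_{\partial V}\equiv0$. $(G,L)$ is non-degenerate if $\mathcal{U}_0(G,L,R)=0$.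 For a field $F$, $R^*(G,F)$ is the $F$-algebra $F[t_x\ (x\in V),\ t_e^{\pm1}\ (e\in E)]$ in indeterminates with $t_e=t_{\overline{e}}$ (one indeterminate per vertex, one invertible indeterminate per undirected edge), and $L^*(G,F)$ is the generalized Laplacian over $R^*(G,F)$ with $w^*(e)=t_e$, $d^*(x)=t_x$. Simple layerable extensions: $G'$ is obtained from $G$ by (i) adjoining an isolated boundary vertex $x$ if $V(G')=V(G)\sqcup\{x\}$, $E(G')=E(G)$, $V^\circ(G')=V^\circ(G)$, and $x$ is a boundary vertex of $G'$ with no incident edges; (ii) adjoining a boundary spike $e$ if $V(G')=V(G)\sqcup\{e_+\}$, $E(G')=E(G)\sqcup\{e,\overline{e}\}$, $V^\circ(G')=V^\circ(G)\sqcup\{e_-\}$, where in $G'$ the vertex $e_-$ is interior and $e_+$ is a boundary vertex with no other incident edges (so $e_-\in\partial V(G)$); (iii) adjoining a boundary edge $e$ if $V(G')=V(G)$, $V^\circ(G')=V^\circ(G)$, $E(G')=E(G)\sqcup\{e,\overline{e}\}$ and both endpoints of $e$ are boundary vertices. A finite $\partial$-graph $G$ is layerable if there is a finite sequence $\varnothing=G_0\subseteq G_1\subseteq\dots\subseteq G_n=G$ with each $G_j$ obtained from $G_{j-1}$ by one of (i)–(iii). *)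

(* Defs.v *)
From HB Require Import structures.
From mathcomp Require Import all_boot all_algebra.
From mathcomp Require Import boolp.
From mathcomp Require Import freeg mpoly.
Set Implicit Arguments.
Unset Strict Implicit.
Unset Printing Implicit Defensive.
Import GRing.Theory.
Local Open Scope ring_scope.
Local Open Scope quotient_scope.

Section QuotientModule.
Context {R : pzRingType} {V : lmodType R}.

Inductive in_span (S : V -> Prop) : V -> Prop :=
| span_gen v of S v : in_span S v
| span0 : in_span S 0
| spanD v w of in_span S v & in_span S w : in_span S (v + w)
| spanZ a v of in_span S v : in_span S (a *: v).

Definition spanb (S : V -> Prop) : {pred V} := fun v => `[< in_span S v >].

Lemma spanbP S v : reflect (in_span S v) (v \in spanb S).
Proof. exact: asboolP. Qed.

Lemma spanb_zmod_closed S : zmod_closed (spanb S).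
Proof.
split=> [|v w /spanbP Sv /spanbP Sw]; first exact/spanbP/span0.
by apply/spanbP/spanD => //; rewrite -scaleN1r; apply: spanZ.
Qed.

HB.instance Definition _ S := GRing.isZmodClosed.Build V (spanb S)
  (spanb_zmod_closed S).

(* The quotient of V by the submodule spanned by S. *)
Definition quotmod (S : V -> Prop) : Type := Quotient.quot (spanb S).

HB.instance Definition _ S := GRing.Zmodule.on (quotmod S).

Definition qclass (S : V -> Prop) (v : V) : quotmod S :=
  \pi_(Quotient.quot (spanb S)) v.
Definition qrepr (S : V -> Prop) (q : quotmod S) : V :=
  repr (q : Quotient.quot (spanb S)).

Lemma qreprK S : cancel (@qrepr S) (@qclass S).
Proof. exact: reprK. Qed.

Lemma qclass_eqP S v w : qclass S v = qclass S w <-> in_span S (v - w).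
Proof.
have E := Quotient.idealrBE (spanb S) v w.
by split=> [/eqP|/spanbP]; [rewrite -E => /spanbP | rewrite E => /eqP].
Qed.

Lemma qclassD S v w : qclass S (v + w) = qclass S v + qclass S w.
Proof. by rewrite /qclass raddfD. Qed.

Definition qscale S (a : R) (q : quotmod S) : quotmod S :=
  qclass S (a *: qrepr q).

Lemma qscaleE S a v : qscale a (qclass S v) = qclass S (a *: v).
Proof.
apply/qclass_eqP; rewrite -scalerBr; apply/spanZ/qclass_eqP.
exact: qreprK.
Qed.

Fact qscaleA S a b (q : quotmod S) :
  qscale a (qscale b q) = qscale (a * b) q.
Proof. by rewrite -[q]qreprK !qscaleE scalerA. Qed.

Fact qscale1 S : left_id 1 (@qscale S).
Proof. by move=> q; rewrite -[q]qreprK qscaleE scale1r. Qed.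

Fact qscaleDr S : right_distributive (@qscale S) +%R.
Proof.
move=> a p q; rewrite -[p]qreprK -[q]qreprK.
by rewrite -qclassD !qscaleE -qclassD scalerDr.
Qed.

Fact qscaleDl S (q : quotmod S) : {morph (@qscale S)^~ q : a b / a + b}.
Proof.
by move=> a b /=; rewrite -[q]qreprK !qscaleE -qclassD scalerDl.
Qed.

HB.instance Definition _ S := GRing.Zmodule_isLmodule.Build R (quotmod S)
  (@qscaleA S) (@qscale1 S) (@qscaleDr S) (@qscaleDl S).

Fact qclass_is_linear S : linear (qclass S).
Proof. by move=> a v w; rewrite qclassD -qscaleE. Qed.

HB.instance Definition _ S := GRing.isLinear.Build R V (quotmod S) _ (qclass S)
  (@qclass_is_linear S).

End QuotientModule.

Definition is_basis (R : pzRingType) (M : lmodType R) (I : choiceType)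
    (b : I -> M) : Prop :=
  (forall m : M, exists (s : seq I) (c : I -> R), m = \sum_(i <- s) c i *: b i)
  /\ (forall (s : seq I) (c : I -> R), uniq s ->
        \sum_(i <- s) c i *: b i = 0 -> forall i, i \in s -> c i = 0).

Definition free_module (R : pzRingType) (M : lmodType R) : Prop :=
  exists (I : choiceType) (b : I -> M), is_basis b.

Section TensorProduct.
Context {R : comNzRingType}.

Section Tensor.
Variables M N : lmodType R.

Inductive bilinear_rel : {freeg (M * N) / R} -> Prop :=
| bilinear_addl m m' n :
    bilinear_rel (<< (m + m', n) >> - (<< (m, n) >> + << (m', n) >>))
| bilinear_addr m n n' :
    bilinear_rel (<< (m, n + n') >> - (<< (m, n) >> + << (m, n') >>))
| bilinear_scalel a m n :
    bilinear_rel (<< (a *: m, n) >> - a *: << (m, n) >>)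
| bilinear_scaler a m n :
    bilinear_rel (<< (m, a *: n) >> - a *: << (m, n) >>).

Definition tensor : lmodType R := quotmod bilinear_rel.

Definition tens (m : M) (n : N) : tensor := qclass bilinear_rel << (m, n) >>.

End Tensor.

Variable M : lmodType R.
Variables N N' : lmodType R.

Definition idtens_free (f : N -> N') (z : {freeg (M * N) / R}) :
    {freeg (M * N') / R} :=
  fglift (fun p : M * N => << (p.1, f p.2) >>) z.

(* The map id (x) f : M (x) N -> M (x) N' induced by f, see idtensE and
   idtens_is_linear. *)
Definition idtens (f : N -> N') (t : tensor M N) : tensor M N' :=
  qclass (@bilinear_rel M N') (idtens_free f (qrepr t)).

Fact idtens_free_is_additive (f : N -> N') : zmod_morphism (idtens_free f).
Proof. exact: lift_is_additive. Qed.

HB.instance Definition _ (f : N -> N') := GRing.isZmodMorphism.Build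
  {freeg (M * N) / R} {freeg (M * N') / R} (idtens_free f)
  (idtens_free_is_additive f).

Fact idtens_free_is_scalable (f : N -> N') : scalable (idtens_free f).
Proof.
move=> a u; rewrite -[u in RHS]freeg_sumE !raddf_sum.
by apply: eq_bigr => p _; rewrite /= /idtens_free !liftU scalerA.
Qed.

HB.instance Definition _ (f : N -> N') := GRing.isScalable.Build R
  {freeg (M * N) / R} {freeg (M * N') / R} _ (idtens_free f)
  (idtens_free_is_scalable f).

Lemma idtens_freeU (f : N -> N') m n :
  idtens_free f << (m, n) >> = << (m, f n) >>.
Proof. by rewrite /idtens_free liftU scale1r. Qed.

Lemma idtens_free_span (f : {linear N -> N'}) z :
  in_span (@bilinear_rel M N) z ->
  in_span (@bilinear_rel M N') (idtens_free f z).
Proof.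
elim=> {z} [z|||a z _ IH].
- case=> [m m' n|m n n'|a m n|a m n]; apply: span_gen;
    rewrite linearB /= ?[idtens_free f (_ + _)]linearD;
    rewrite ?[idtens_free f (_ *: _)]linearZ /= !idtens_freeU;
    rewrite ?[f (_ + _)]linearD ?[f (_ *: _)]linearZ /=;
    by constructor.
- by rewrite linear0; apply: span0.
- by move=> v w _ IHv _ IHw; rewrite linearD; apply: spanD.
- by rewrite linearZ; apply: spanZ.
Qed.

Lemma idtens_qclass (f : {linear N -> N'}) z :
  idtens f (qclass (@bilinear_rel M N) z) =
  qclass (@bilinear_rel M N') (idtens_free f z).
Proof.
apply/qclass_eqP; rewrite -linearB; apply/idtens_free_span/qclass_eqP.
exact: qreprK.
Qed.

Lemma idtensE (f : {linear N -> N'}) m n :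
  idtens f (tens m n) = tens m (f n).
Proof. by rewrite /tens idtens_qclass idtens_freeU. Qed.

Lemma idtens_is_linear (f : {linear N -> N'}) : linear (idtens f).
Proof.
move=> a t u; rewrite -[t]qreprK -[u]qreprK -linearP !idtens_qclass.
by rewrite !linearP.
Qed.

End TensorProduct.

Definition flat (R : comNzRingType) (M : lmodType R) : Prop :=
  forall (N N' : lmodType R) (f : {linear N -> N'}),
    injective f -> injective (idtens (M := M) f).

(* A finite undirected multigraph with boundary: [edge] is the set of oriented
   edges, [start e] is e_+.  Parallel edges and self-loops are allowed. *)
Record dgraph := DGraph {
  vert : finType;
  edge : finType;
  erev : edge -> edge;
  start : edge -> vert;
  interior : {set vert};
  erevK : involutive erev;
  erev_neq : forall e, erev e != e
}.

Definition stop (G : dgraph) (e : edge G) : vert G := start (erev e).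

Definition boundary (G : dgraph) : {set vert G} := ~: interior G.

(* The dgraphs [H] with [H \subseteq G]. *)
Record subdgraph (G : dgraph) := SubDGraph {
  sV : {set vert G};
  sE : {set edge G};
  sI : {set vert G};
  sE_rev : forall e, e \in sE -> erev e \in sE;
  sE_start : forall e, e \in sE -> start e \in sV;
  sI_sub : sI \subset sV
}.

Definition sB (G : dgraph) (H : subdgraph G) : {set vert G} := sV H :\: sI H.

(* In [adjoin_isolated] and [adjoin_spike], [sE_start H] and [sI_sub H] ensure
   that the new vertex is a boundary vertex of [H'] without further incident
   edges. *)
Inductive simple_layerable_extension (G : dgraph) (H H' : subdgraph G) : Prop :=
| adjoin_isolated x of
    x \notin sV H &
    sV H' = x |: sV H & sE H' = sE H & sI H' = sI H
| adjoin_spike e of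
    start e \notin sV H & e \notin sE H & stop e \in sB H &
    sV H' = start e |: sV H & sE H' = sE H :|: [set e; erev e] &
    sI H' = stop e |: sI H
| adjoin_boundary_edge e of
    e \notin sE H & start e \in sB H & stop e \in sB H &
    sV H' = sV H & sE H' = sE H :|: [set e; erev e] & sI H' = sI H.

Definition layerable (G : dgraph) : Prop :=
  exists (n : nat) (H : nat -> subdgraph G),
    [/\ [/\ sV (H 0%N) = set0, sE (H 0%N) = set0 & sI (H 0%N) = set0],
        forall j, (j < n)%N -> simple_layerable_extension (H j) (H j.+1)
      & [/\ sV (H n) = setT, sE (H n) = setT & sI (H n) = interior G]].

Record network (R : comPzRingType) (G : dgraph) := Network {
  weight : edge G -> R;
  diag : vert G -> R;
  weight_rev : forall e, weight (erev e) = weight e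
}.

Section Network.
Context {R : comPzRingType} {G : dgraph}.
Variable L : network R G.

Definition unit_network : Prop :=
  forall e, exists v : R, weight L e * v = 1.

Notation RV := {ffun vert G -> R^o}.

Definition bvec (x : vert G) : RV := [ffun y => (y == x)%:R].

Definition lap_bvec (x : vert G) : RV :=
  diag L x *: bvec x
  + \sum_(e : edge G | start e == x) weight L e *: (bvec x - bvec (stop e)).

Definition lap (v : RV) : RV := \sum_x v x *: lap_bvec x.

(* RV°, the free submodule of RV on the interior vertices *)
Definition in_RVint (v : RV) : Prop :=
  forall x, x \notin interior G -> v x = 0.

Definition Upsilon : lmodType R :=
  quotmod (fun v : RV => exists2 u : RV, in_RVint u & v = lap u).

Definition lap_fun (M : lmodType R) (u : {ffun vert G -> M}) :
    {ffun vert G -> M} :=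
  [ffun x => diag L x *: u x
     + \sum_(e : edge G | start e == x) weight L e *: (u x - u (stop e))].

Definition U0 (M : lmodType R) (u : {ffun vert G -> M}) : Prop :=
  (forall x, lap_fun u x = 0) /\ (forall x, x \in boundary G -> u x = 0).

Definition non_degenerate : Prop :=
  forall u : {ffun vert G -> R^o}, U0 u -> u = 0.

End Network.

Section GenericRing.
Variables (G : dgraph) (F : fieldType).

(* Undirected edges: orbits of [erev]. *)
Definition uedge : finType :=
  {A : {set edge G} | A \in [set [set e; erev e] | e : edge G]}.

Fact uedge_of_subproof (e : edge G) :
  [set e; erev e] \in [set [set f; erev f] | f : edge G].
Proof. exact: imset_f. Qed.

Definition uedge_of (e : edge G) : uedge :=
  exist _ [set e; erev e] (uedge_of_subproof e).

Lemma uedge_of_rev e : uedge_of (erev e) = uedge_of e.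
Proof. by apply: val_inj; rewrite /= erevK setUC. Qed.

Definition gen_poly : idomainType := {mpoly F[#|{: vert G + uedge}|]}.

Definition Xvert (x : vert G) : gen_poly := 'X_(enum_rank (inl uedge x)).
Definition Xedge (a : uedge) : gen_poly := 'X_(enum_rank (inr (vert G) a)).

(* F[t_x, t_e^{+-1}], as the subring of the fraction field of F[t_x, t_e]
   consisting of the fractions whose denominator is a monomial in the t_e. *)
Definition Rstar_pred : {pred {fraction gen_poly}} := fun z =>
  `[< exists (p : gen_poly) (m : uedge -> nat),
        z = tofrac p / tofrac (\prod_a Xedge a ^+ m a) >].

Lemma Rstar_predP z :
  reflect (exists (p : gen_poly) (m : uedge -> nat),
             z = tofrac p / tofrac (\prod_a Xedge a ^+ m a))
          (z \in Rstar_pred).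
Proof. exact: asboolP. Qed.

Lemma Xedge_neq0 a : Xedge a != 0.
Proof. by rewrite -msize_poly_eq0 msizeX. Qed.

Lemma prod_Xedge_neq0 (m : uedge -> nat) :
  tofrac (\prod_a Xedge a ^+ m a) != 0.
Proof.
rewrite tofrac_eq0; apply/prodf_neq0 => a _.
by rewrite expf_neq0 ?Xedge_neq0.
Qed.

Fact Rstar_subring_closed : subring_closed Rstar_pred.
Proof.
have M m m' : \prod_a Xedge a ^+ (m a + m' a)
    = (\prod_a Xedge a ^+ m a) * (\prod_a Xedge a ^+ m' a).
  by rewrite -big_split; apply: eq_bigr => a _; rewrite exprD.
split=> [|y z|y z].
- apply/Rstar_predP; exists 1, (fun=> 0%N); rewrite tofrac1.
  by rewrite big1 ?tofrac1 ?divr1 // => a _; rewrite expr0.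
- move=> /Rstar_predP[p [m ->]] /Rstar_predP[q [m' ->]].
  apply/Rstar_predP.
  exists (p * (\prod_a Xedge a ^+ m' a) - q * (\prod_a Xedge a ^+ m a)).
  exists (fun a => m a + m' a)%N; rewrite M -mulNr addf_div ?prod_Xedge_neq0 //.
  by rewrite tofracB !tofracM mulNr.
- move=> /Rstar_predP[p [m ->]] /Rstar_predP[q [m' ->]].
  apply/Rstar_predP; exists (p * q), (fun a => m a + m' a)%N.
  by rewrite M mulf_div !tofracM.
Qed.

HB.instance Definition _ := GRing.isSubringClosed.Build {fraction gen_poly}
  Rstar_pred Rstar_subring_closed.

Record Rstar : Type := RStar {
  Rstar_val :> {fraction gen_poly};
  _ : Rstar_val \in Rstar_pred
}.

HB.instance Definition _ := [isSub for Rstar_val].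
HB.instance Definition _ := [Choice of Rstar by <:].
HB.instance Definition _ := [SubChoice_isSubComNzRing of Rstar by <:].

Fact Rstar_poly_subproof (p : gen_poly) : tofrac p \in Rstar_pred.
Proof.
apply/Rstar_predP; exists p, (fun=> 0%N).
by rewrite big1 ?tofrac1 ?divr1 // => a _; rewrite expr0.
Qed.

Definition Rstar_poly (p : gen_poly) : Rstar := RStar (Rstar_poly_subproof p).

Definition tvert (x : vert G) : Rstar := Rstar_poly (Xvert x).
Definition tedge (e : edge G) : Rstar := Rstar_poly (Xedge (uedge_of e)).

Lemma tedge_rev e : tedge (erev e) = tedge e.
Proof. by rewrite /tedge uedge_of_rev. Qed.

Definition Lstar : network Rstar G := Network tvert tedge_rev.

Fact Lstar_unit : unit_network Lstar.
Proof.
move=> e; set a := uedge_of e.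
have Va : (tofrac (Xedge a))^-1 \in Rstar_pred.
  apply/Rstar_predP; exists 1, (fun b => b == a : nat).
  rewrite tofrac1 mul1r (bigD1 a) //= eqxx expr1 big1 ?mulr1 // => b /negPf->.
  by rewrite expr0.
exists (RStar Va); apply: val_inj => /=.
by rewrite divff // tofrac_eq0 Xedge_neq0.
Qed.

End GenericRing.

(* Main.v *)
Require Import Defs.
From HB Require Import structures.
From mathcomp Require Import all_boot all_algebra.
From mathcomp Require Import boolp.
From mathcomp Require Import freeg mpoly.
Set Implicit Arguments.
Unset Strict Implicit.
Unset Printing Implicit Defensive.
Import GRing.Theory.
Local Open Scope ring_scope.

(** If [G] is layerable, let Y be the set of the tips of the boundary spikes in
    a layering. With the spikes in the order of the layering, the block of [L]
    with rows in Y and columns in the interior of [G] is triangular, and its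
    diagonal entries are the opposites of the weights of the spikes. Over any
    ring where the weights are units, this block is thus invertible
    ([layered_solve]): an interior function killed by [L] is zero, and Upsilon
    is free on the classes of the vertices outside of Y.

    Conversely, removing layers from the outside of a graph that is not
    layerable leads to a nonempty subgraph H where nothing can be removed: each
    boundary vertex of H has at least two edges, all leading to the interior of
    H. Over a field with at least three elements, nonzero weights on the edges
    at each boundary vertex can be chosen with sum zero, so the function equal
    to 1 on the interior of H and to 0 elsewhere is killed by a suitable
    generalized Laplacian on [G]: some network on [G] is degenerate
    ([irreducible_degenerate], [layerable_of_non_degenerate]).

    The remaining implications go through the generic network. Its determinant
    is a nonzero polynomial, so it is non-degenerate and [L] gives a free
    resolution of length one of its Upsilon. If this Upsilon is free, it is flat
    ([free_flat]). If it is flat, then Tor_1 vanishes and the resolution remains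
    injective modulo every ideal ([flat_reflects_ideal]). Applied to the kernel
    of a specialization of the indeterminates, this says that the specialized
    network is non-degenerate ([flat_specialization_non_degenerate]). *)

(** * The generalized Laplacian *)

Section FfunOps.
Variables (I : finType) (R : pzRingType).
Implicit Types f g : {ffun I -> R^o}.

Lemma ffun_addE f g x : (f + g) x = f x + g x. Proof. by rewrite ffunE. Qed.

Lemma ffun_subE f g x : (f - g) x = f x - g x. Proof. by rewrite !ffunE. Qed.

Lemma ffun_scaleE a f x : (a *: f) x = a * f x. Proof. by rewrite ffunE. Qed.

End FfunOps.

Section Laplacian.
Variables (R : comPzRingType) (G : dgraph) (L : network R G).
Implicit Types u v : {ffun vert G -> R^o}.

Lemma lap_fun_linear : linear (lap_fun L (M := R^o)).
Proof.
move=> a u v; apply/ffunP=> x; rewrite !ffunE [in RHS]scalerDr.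
rewrite [in RHS]scaler_sumr addrACA -big_split /=; congr (_ + _).
  by rewrite scalerDr !scalerA mulrC.
apply: eq_bigr => e _; rewrite !ffunE !scalerBr !scalerDr !scalerA.
by rewrite (mulrC (weight L e)) opprD addrACA.
Qed.

HB.instance Definition _ := GRing.isLinear.Build R {ffun vert G -> R^o}
  {ffun vert G -> R^o} _ (lap_fun L (M := R^o)) lap_fun_linear.

Lemma lap_funE u x :
  lap_fun L u x = diag L x * u x
    + \sum_(e : edge G | start e == x) weight L e * (u x - u (stop e)).
Proof. by rewrite ffunE. Qed.

Lemma bvec_decomp v : v = \sum_x v x *: bvec x.
Proof.
apply/ffunP=> y; rewrite sum_ffunE (bigD1 y) //= !ffunE eqxx big1 ?addr0.
  by rewrite /GRing.scale /= mulr1.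
by move=> x nxy; rewrite !ffunE eq_sym (negPf nxy) scaler0.
Qed.

(** The matrix of [L] in the basis of the [bvec x] is symmetric, because
    [weight] is invariant under [erev]; hence the endomorphism [lap] of RV and
    the operator [lap_fun] on functions coincide. *)
Lemma lap_bvecE x : lap_bvec L x = lap_fun L (bvec x).
Proof.
apply/ffunP=> y; rewrite !ffunE sum_ffunE.
under eq_bigr do rewrite !ffunE scalerBr.
under [in RHS]eq_bigr do rewrite !ffunE scalerBr.
rewrite !big_split /=; congr (_ + (_ + _)).
- by have [->|] := eqVneq y x; rewrite ?scaler0.
- have [->//|nxy] := eqVneq y x.
  by rewrite !big1 // => e _; rewrite scaler0.
rewrite !sumrN; congr (- _).
rewrite big_mkcond [RHS]big_mkcond /=.
rewrite [RHS](reindex_inj (inv_inj (@erevK G))) /=.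
apply: eq_bigr => e _; rewrite weight_rev /stop erevK.
rewrite [y == _]eq_sym.
by case: (start e == x); case: (_ == y); rewrite ?scaler0.
Qed.

Lemma lapE v : lap L v = lap_fun L v.
Proof.
rewrite {2}[v]bvec_decomp linear_sum; apply: eq_bigr => x _.
by rewrite linearZ lap_bvecE.
Qed.

End Laplacian.

(** * Layerings *)

Section Layering.
Variable G : dgraph.
Implicit Types (H : subdgraph G) (e : edge G).

(** The subgraphs reached from the empty one by simple layerable extensions. *)
Inductive layered : subdgraph G -> Prop :=
| layered0 H of sV H = set0 & sE H = set0 & sI H = set0 : layered H
| layeredS H H' of layered H & simple_layerable_extension H H' : layered H'.

Lemma layeredP H : layered H <->
  exists n (K : nat -> subdgraph G),
    [/\ [/\ sV (K 0%N) = set0, sE (K 0%N) = set0 & sI (K 0%N) = set0],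
        forall j, (j < n)%N -> simple_layerable_extension (K j) (K j.+1)
      & K n = H].
Proof.
split.
  elim=> {H} [H V0 E0 I0|H H' _ [n [K [K0 Kstep Kn]]] HH'].
    by exists 0%N, (fun=> H).
  exists n.+1, (fun j => if (j <= n)%N then K j else H'); split=> // [j|].
    rewrite ltnS => le_jn; rewrite le_jn.
    by case: ltngtP le_jn => // [lt_jn|->] _; [apply: Kstep | rewrite Kn].
  by rewrite ltnn.
case=> n [K [K0 Kstep <-]] {H}.
elim: n Kstep => [_|n IHn Kstep]; first by case: K0 => *; apply: layered0.
apply: layeredS (Kstep _ (ltnSn n)); apply: IHn => j lt_jn.
exact/Kstep/ltnW.
Qed.

(** [G] as a subgraph of itself. *)
Definition full_sub : subdgraph G :=
  @SubDGraph G setT setT (interior G) (fun _ _ => in_setT _)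
    (fun _ _ => in_setT _) (subsetT _).

Lemma sE_revE H e : (erev e \in sE H) = (e \in sE H).
Proof. by apply/idP/idP => /sE_rev; rewrite ?erevK. Qed.

(** All the edges of [G] at an interior vertex of [H] already belong to [H], so
    that [L] of a function supported on [sI H] is computed inside [H] at the
    vertices of [H] and vanishes at the other ones; moreover the interior
    vertices of [H] are interior in [G]. *)
Definition saturated H : Prop :=
  sI H \subset interior G /\ forall e, e \notin sE H -> start e \notin sI H.

(** Saturation goes down a layering.  As the full subgraph is saturated, so is
    every layer. *)
Lemma saturated_ext H H' :
  simple_layerable_extension H H' -> saturated H' -> saturated H.
Proof.
have subV x : x \notin sV H -> x \notin sI H.
  by apply: contraNN; apply/subsetP/sI_sub.
move=> HH' [I'G satH'].
case: HH' => [x _ _ E' I'|e yV _ xB _ E' I'|e _ yB xB _ E' I'].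
- by split; rewrite -I' // -E'.
- split; first by apply: subset_trans I'G; rewrite I' subsetUr.
  move=> f nEf; have := satH' f; rewrite E' I' !inE (negPf nEf) /=.
  have [-> _|_] := eqVneq f e; first exact: subV.
  have [-> _|_ /(_ isT)] := eqVneq f (erev e); last first.
    by rewrite negb_or => /andP[].
  by move: xB; rewrite inE => /andP[].
- split; rewrite -I' // => f nEf.
  have := satH' f; rewrite E' !inE (negPf nEf) /=.
  have [-> _|_] := eqVneq f e; first by move: yB; rewrite I' inE => /andP[].
  have [-> _|_ /(_ isT)//] := eqVneq f (erev e).
  by move: xB; rewrite I' inE => /andP[].
Qed.

Lemma saturated_full : saturated full_sub.
Proof. by split=> // e; rewrite inE. Qed.

End Layering.

Section TriangularSystem.
Variables (R : comPzRingType) (G : dgraph) (L : network R G).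
Hypothesis unitL : unit_network L.
Implicit Types (H : subdgraph G) (u : {ffun vert G -> R^o}).

(** [u] vanishes outside of [I]. *)
Definition supported_on (I : {set vert G}) u : Prop :=
  forall x, x \notin I -> u x = 0.

Lemma lap_fun_outside H u y : saturated H -> supported_on (sI H) u ->
  y \notin sV H -> lap_fun L u y = 0.
Proof.
move=> [_ satH] uI yV; have nI x : x \notin sV H -> x \notin sI H.
  by apply: contraNN; apply/subsetP/sI_sub.
rewrite lap_funE uI ?nI // mulr0 add0r big1 // => e /eqP ye.
rewrite uI ?subr0 ?mulr0 //; apply: satH; rewrite sE_revE.
by apply: contraNN yV; rewrite -ye; apply: sE_start.
Qed.

(** The pivot: in a saturated [H'], the only edge joining the tip of the last
    spike to its foot is the spike itself. *)
Lemma lap_fun_spike H H' e : saturated H' ->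
  start e \notin sV H -> e \notin sE H -> stop e \in sV H ->
  sE H' = sE H :|: [set e; erev e] -> stop e \in sI H' ->
  lap_fun L (bvec (stop e)) (start e) = - weight L e.
Proof.
move=> [_ satH'] yV eE xV E' xI'; set x := stop e; set y := start e.
have nyx : (y == x) = false by apply: contraNF yV => /eqP; rewrite -/y => ->.
rewrite lap_funE !ffunE nyx mulr0 add0r (bigD1 e) //= ffunE eqxx sub0r.
rewrite mulrN1 big1 ?addr0 // => f /andP[/eqP fy nfe].
rewrite ffunE; case: eqP => [fx|_]; last by rewrite subr0 mulr0.
have fE' : f \in sE H'.
  by rewrite -sE_revE; apply: contraTT xI' => /satH'; rewrite -/(stop f) fx.
move: fE'; rewrite E' !inE (negPf nfe) /= => /orP[/sE_start|/eqP fe].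
  by rewrite fy (negPf yV).
by case/eqP: nyx; rewrite -[LHS]fy fe.
Qed.

(** [Y] is the set of the tips of the spikes. The system of the equations
    [lap_fun L u y = g y] is square and triangular, with pivots, up to sign, the
    weights of the spikes: the tip of a spike lies outside of the layers that precede
    it, so [L] of a function supported on their interior vanishes there. *)
Lemma layered_solve H : layered H -> saturated H ->
  exists2 Y : {set vert G}, Y \subset sV H & forall g : vert G -> R^o,
    exists! u, supported_on (sI H) u /\ {in Y, forall y, lap_fun L u y = g y}.
Proof.
elim=> {H} [H _ _ I0|H H' _ IH HH'] satH'.
  exists set0; first exact: sub0set.
  move=> g; exists 0; split; first by split=> [x|y]; rewrite ?inE // ffunE.
  move=> u [uI _]; apply/ffunP=> x; rewrite ffunE uI //.
  by rewrite I0 inE.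
have satH := saturated_ext HH' satH'; have [Y YV solveY] := IH satH.
case: HH' => [x _ V' _ I'|e yV eE xB V' E' I'|e _ _ _ V' _ I'].
- by exists Y; rewrite ?I' // V' subsetU // YV orbT.
- exists (start e |: Y); first by rewrite V' setUS.
  move=> g; set x := stop e; set y := start e.
  have [xI xV] : x \notin sI H /\ x \in sV H.
    by move: xB; rewrite inE => /andP.
  have Lxy : lap_fun L (bvec x) y = - weight L e.
    by apply: lap_fun_spike yV eE xV E' _; rewrite // I' !inE eqxx.
  have [w ew] := unitL e; pose c := - (g y * w).
  have [u [[uI uY] u_uniq]] :=
    solveY (fun z => g z - c * lap_fun L (bvec x) z).
  (* Off its value at the foot [x] of the spike, a function supported on [sI H']
     is supported on [sI H]. *)
  have splitP v : supported_on (sI H') v ->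
      supported_on (sI H) (v - v x *: bvec x).
    move=> vI' z zI; rewrite ffun_subE ffun_scaleE ffunE.
    have [->|nzx] := eqVneq z x.
      by rewrite mulr1 subrr.
    by rewrite mulr0 subr0 vI' // I' !inE (negPf nzx).
  exists (u + c *: bvec x); split.
    split=> [z|z].
      rewrite I' !inE negb_or ffun_addE ffun_scaleE ffunE.
      case/andP=> /negPf-> /uI->.
      by rewrite mulr0 addr0.
    rewrite linearD linearZ /= ffun_addE ffun_scaleE => /setU1P[->|zY].
      rewrite (lap_fun_outside satH uI yV) add0r Lxy.
      by rewrite mulrNN -mulrA [w * _]mulrC ew mulr1.
    by rewrite uY // subrK.
  move=> v [vI' vY]; have vI := splitP v vI'.
  have vx : v x = c.
    have := lap_fun_outside satH vI yV.
    rewrite linearB linearZ /= ffun_subE ffun_scaleE Lxy vY ?setU11 //.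
    rewrite mulrN opprK.
    move/eqP; rewrite addr_eq0 /c => /eqP->.
    by rewrite mulNr opprK -mulrA ew mulr1.
  rewrite (u_uniq (v - v x *: bvec x)) ?vx ?subrK //; split=> [|z zY].
    by rewrite -vx.
  by rewrite linearB linearZ /= ffun_subE ffun_scaleE vY // inE zY orbT.
- by exists Y; rewrite ?I' // V'.
Qed.

End TriangularSystem.

(** * Networks on layerable graphs *)

Section SpanLap.
Variables (R : comPzRingType) (G : dgraph) (L : network R G).
Implicit Types u v : {ffun vert G -> R^o}.

(** The image under [L] of a submodule is its own span. *)
Lemma in_span_lap_image (P : {ffun vert G -> R^o} -> Prop) v :
  P 0 -> (forall u w, P u -> P w -> P (u + w)) ->
  (forall a u, P u -> P (a *: u)) ->
  in_span (fun v => exists2 u, P u & v = lap L u) v ->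
  exists2 u, P u & v = lap_fun L u.
Proof.
move=> P0 PD PZ; elim=> {v} [v [u Pu ->]||v w _ [u Pu ->] _ [u' Pu' ->]|].
- by exists u; rewrite ?lapE.
- by exists 0; rewrite ?linear0.
- by exists (u + u'); [apply: PD | rewrite linearD].
- by move=> a v _ [u Pu ->]; exists (a *: u); [apply: PZ | rewrite linearZ].
Qed.

Lemma in_RVint0 : in_RVint (0 : {ffun vert G -> R^o}).
Proof. by move=> x _; rewrite ffunE. Qed.

Lemma in_RVintD u v : in_RVint u -> in_RVint v -> in_RVint (u + v).
Proof. by move=> uI vI x xI; rewrite ffunE uI ?vI ?addr0. Qed.

Lemma in_RVintZ a u : in_RVint u -> in_RVint (a *: u).
Proof. by move=> uI x xI; rewrite ffunE uI ?scaler0. Qed.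

End SpanLap.

Section Layerable.
Variables (R : comPzRingType) (G : dgraph) (L : network R G).
Hypothesis unitL : unit_network L.
Hypothesis layG : layerable G.
Implicit Types u v : {ffun vert G -> R^o}.

Lemma layerable_solve : exists Y : {set vert G}, forall g : vert G -> R^o,
  exists! u, in_RVint u /\ {in Y, forall y, lap_fun L u y = g y}.
Proof.
case: layG => n [K [K0 Kstep [_ En In]]].
have layK : layered (K n) by apply/layeredP; exists n, K.
have satK : saturated (K n) by split=> [|e]; rewrite ?In // En inE.
have [Y _ solveY] := layered_solve unitL layK satK.
by exists Y; rewrite In in solveY.
Qed.

Lemma layerable_non_degenerate : non_degenerate L.
Proof.
move=> u [Lu0 uB]; have [Y /(_ (fun=> 0)) [v [_ v_uniq]]] := layerable_solve.
rewrite -(v_uniq 0); last first.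
  by split=> [x _|y _]; rewrite ?linear0 ffunE.
apply/esym/v_uniq; split=> [x xI|y _]; last exact: Lu0.
by apply: uB; rewrite inE.
Qed.

(** By [layerable_solve], RV is the direct sum of the image of the interior
    functions, on which [L] is injective, and of the functions vanishing on [Y].
    So the classes of the [bvec z] with [z] outside of [Y] form a basis. *)
Lemma layerable_Upsilon_free : free_module (Upsilon L).
Proof.
have [Y solveY] := layerable_solve.
exists {z : vert G | z \notin Y}.
pose b (z : {z : vert G | z \notin Y}) : {ffun vert G -> R^o} :=
  bvec (val z).
have bE z x : b z x = (x == val z)%:R by rewrite ffunE.
exists (fun z => qclass _ (b z)); split=> [m|s c uniq_s].
  have [u [[uI uY] _]] := solveY (qrepr m).
  pose w := qrepr m - lap_fun L u.
  exists (index_enum {z : vert G | z \notin Y}), (fun z => w (val z)).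
  under eq_bigr do rewrite -linearZ; rewrite -linear_sum.
  rewrite -[LHS]qreprK; apply/qclass_eqP/span_gen; exists u => //.
  rewrite lapE.
  suff -> : \sum_z w (val z) *: b z = w by rewrite subKr.
  apply/ffunP=> x; rewrite sum_ffunE; have [xY|xY] := boolP (x \in Y).
    rewrite big1 => [|z _]; first by rewrite ffun_subE uY ?subrr ?ffunE.
    rewrite ffun_scaleE bE; case: eqP (valP z) => [<-|_ _]; rewrite ?xY //.
    by rewrite mulr0.
  rewrite (bigD1 (Sub x xY)) //= big1 ?addr0 => [|z nzx].
    by rewrite ffun_scaleE bE eqxx mulr1.
  rewrite ffun_scaleE bE; case: eqP => [xz|]; last by rewrite mulr0.
  by case/eqP: nzx; apply: val_inj.
under eq_bigr do rewrite -linearZ; rewrite -linear_sum => sum0.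
have /qclass_eqP := etrans sum0 (esym (linear0 (qclass _))).
rewrite subr0.
case/(in_span_lap_image (@in_RVint0 _ _) (@in_RVintD _ _) (@in_RVintZ _ _))
  => u uI sumE.
have u0 : u = 0.
  have [v [_ v_uniq]] := solveY (fun=> 0).
  rewrite -(v_uniq 0); last by split=> [x _|y _]; rewrite ?linear0 ffunE.
  apply/esym/v_uniq; split=> // y yY; rewrite -sumE sum_ffunE big1 // => z _.
  rewrite ffun_scaleE bE; case: eqP (valP z) => [<-|_ _]; rewrite ?yY //.
  by rewrite mulr0.
move=> i i_s; move/ffunP/(_ (val i)): sumE.
rewrite u0 linear0 sum_ffunE ffunE (bigD1_seq i) //= big1 ?addr0 => [|z nzi].
  by rewrite ffun_scaleE bE eqxx mulr1.
rewrite ffun_scaleE bE; case: eqP => [iz|_]; last by rewrite mulr0.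
by case/eqP: nzi; apply: val_inj.
Qed.

End Layerable.

(** * Graphs that are not layerable *)

Section ZeroSum.
Variable F : fieldType.
Hypothesis F3 : exists a b c : F, uniq [:: a; b; c].

Lemma nonzero_avoid (s : F) : exists2 p : F, p != 0 & p != s.
Proof.
have [a [b [c]]] := F3; rewrite /= !inE negb_or andbT -!andbA.
case/and3P=> nab nac nbc.
have [a0|na0] := eqVneq a 0; have [as_|nas] := eqVneq a s; last by exists a.
- by exists b; rewrite -?as_ -?a0 eq_sym.
- have [bs|nbs] := eqVneq b s; last by exists b; rewrite // -a0 eq_sym.
  by exists c; rewrite -?bs -?a0 eq_sym.
- have [b0|nb0] := eqVneq b 0; last by exists b; rewrite // -as_ eq_sym.
  by exists c; rewrite -?as_ -?b0 eq_sym.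
Qed.

(** This is where two elements would not suffice: over F_2, an odd number of
    nonzero elements never sums to zero. *)
Lemma nonzero_zero_sum (T : finType) (A : {set T}) : (1 < #|A|)%N ->
  exists2 g : T -> F, forall t, g t != 0 & \sum_(t in A) g t = 0.
Proof.
case/card_gt1P=> a [b [aA bA nab]].
pose s : F := \sum_(t in A | (t != a) && (t != b)) 1.
have [p p0 ps] := nonzero_avoid (- s).
(* The value is 1 away from [a] and [b]; the values at [a] and [b] are nonzero
   elements compensating the sum [s] of the others. *)
exists (fun t => if t == a then p else if t == b then - s - p else 1).
  move=> t; case: ifP => // _; case: ifP => _; last exact: oner_neq0.
  by rewrite subr_eq0 eq_sym.
rewrite (bigD1 a) // eqxx (bigD1 b) /=; last by rewrite bA eq_sym.
rewrite eqxx [b == a]eq_sym (negPf nab).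
rewrite [X in _ + (_ + X)](_ : _ = s).
  by rewrite [X in p + X]addrAC addNr sub0r subrr.
apply: eq_big => [t|t /andP[/andP[_ /negPf->] /negPf->]//].
by rewrite andbA.
Qed.

End ZeroSum.

Section Peel.
Variable G : dgraph.
Implicit Types H : subdgraph G.

(** The edges of [H] starting at [x]; a self-loop at [x] counts twice, as both
    of its orientations start at [x]. *)
Definition out_edges H x := [set e in sE H | start e == x].

(** If every boundary vertex of [H] has at least two edges, all leading to
    interior vertices, then the weights of the edges at each boundary vertex can
    be chosen with sum zero. The indicator function [u] of [sI H] is then killed
    by [L] at the boundary vertices of [H], and at the interior ones for a
    suitable diagonal. *)
Lemma irreducible_degenerate (F : fieldType) H :
  (exists a b c : F, uniq [:: a; b; c]) -> saturated H -> sI H != set0 ->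
  (forall x, x \in sB H -> (1 < #|out_edges H x|)%N) ->
  (forall e, e \in sE H -> start e \in sB H -> stop e \in sI H) ->
  exists2 L : network F G, unit_network L & ~ non_degenerate L.
Proof.
move=> F3 [IG satH] /set0Pn[x0 x0I] deg2 B2I.
have [g g_n0 g_sum] : exists2 g : vert G -> edge G -> F,
    forall x e, g x e != 0 &
    forall x, x \in sB H -> \sum_(e in out_edges H x) g x e = 0.
  have gP x : exists h : edge G -> F, (forall e, h e != 0) /\
      (x \in sB H -> \sum_(e in out_edges H x) h e = 0).
    have [/deg2/(nonzero_zero_sum F3)[h]|_] := boolP (x \in sB H).
      by exists h.
    by exists (fun=> 1); split=> // e; apply: oner_neq0.
  have [g gP'] := choice gP.
  by exists g => x; case: (gP' x).
(* By [B2I] an edge of [H] has at most one end in the boundary of [H], so the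
   choices [g] made at distinct boundary vertices are compatible. *)
pose w e : F := if e \notin sE H then 1
  else if start e \in sB H then g (start e) e
  else if stop e \in sB H then g (stop e) (erev e) else 1.
have w_rev e : w (erev e) = w e.
  rewrite /w sE_revE /stop erevK -/(stop e); have [eE|//] := boolP (e \in sE H).
  have [sB_|_] /= := boolP (start e \in sB H); last by [].
  by rewrite inE B2I.
have w_n0 e : w e != 0 by rewrite /w; do 3?case: ifP => _; rewrite ?oner_neq0.
pose u : {ffun vert G -> F^o} := [ffun x => (x \in sI H)%:R].
pose d x : F := if x \in sI H
  then - \sum_(e | start e == x) w e * (u x - u (stop e)) else 0.
pose L := Network d w_rev.
have unitL : unit_network L by move=> e; exists (w e)^-1; rewrite mulfV.
exists L => // /(_ u) u0.
have /ffunP/(_ x0) : u = 0.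
  apply: u0; split=> [x|x]; last first.
    rewrite inE ffunE; case: (boolP (x \in sI H)) => // /(subsetP IG)->//.
  rewrite lap_funE /= /d; have [xI|xI] := boolP (x \in sI H).
    by rewrite {2}/u ffunE xI mulr1 addNr.
  rewrite mul0r add0r.
  have ux : u x = 0 by rewrite ffunE (negPf xI).
  rewrite ux; have [xB|xB] := boolP (x \in sB H).
    rewrite (bigID (mem (sE H))) /= [X in _ + X]big1 ?addr0; last first.
      move=> e /andP[_ eE]; have/negPf eI : stop e \notin sI H.
        by apply: satH; rewrite sE_revE.
      by rewrite ffunE eI subrr mulr0.
    transitivity (- \sum_(e in out_edges H x) g x e); last first.
      by rewrite g_sum ?oppr0.
    rewrite -sumrN; apply: eq_big => [e|e /andP[/eqP ex eE]].
      by rewrite inE andbC.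
    by rewrite /w eE ffunE B2I ?ex ?xB //= mulr1n sub0r mulrN1.
  rewrite big1 // => e /eqP ex; rewrite ffunE.
  have [sI_|_] := boolP (stop e \in sI H); last by rewrite subrr mulr0.
  have eE : e \in sE H.
    by rewrite -sE_revE; apply: contraLR sI_ => /satH.
  have := sE_start eE; rewrite ex => xV.
  by case/negP: xB; rewrite inE xI.
by rewrite !ffunE x0I; apply/eqP/oner_neq0.
Qed.

(** The quantity that decreases when a layer is removed; edges are counted with
    their orientation. *)
Definition sub_size H := (#|sV H| + #|sE H|)%N.

Lemma peel_isolated H x : x \in sB H -> #|out_edges H x| = 0%N ->
  exists2 H', simple_layerable_extension H' H & (sub_size H' < sub_size H)%N.
Proof.
rewrite inE => /andP[xI xV] /cards0_eq out0.
have start_ok e : e \in sE H -> start e \in sV H :\ x.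
  move=> eE; rewrite !inE sE_start // andbT.
  by apply/eqP => ex; move/setP/(_ e): out0; rewrite !inE eE ex eqxx.
have I_ok : sI H \subset sV H :\ x.
  apply/subsetP=> y yI; rewrite !inE (subsetP (sI_sub H)) // andbT.
  by apply: contraNneq xI => <-.
exists (SubDGraph (@sE_rev _ H) start_ok I_ok).
  by apply: (adjoin_isolated (x := x)); rewrite /= ?inE ?eqxx // setD1K.
by rewrite ltn_add2r [in ltnRHS](cardsD1 x) xV.
Qed.

Lemma setD_pairK H e : e \in sE H ->
  sE H = (sE H :\: [set e; erev e]) :|: [set e; erev e].
Proof.
move=> eE; apply/setP=> f; rewrite !inE.
have [->|_] := eqVneq f e; first by rewrite eE orbT.
by have [->|_] := eqVneq f (erev e); rewrite ?sE_revE ?eE ?andbT ?orbF.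
Qed.

Lemma remove_pair_rev H e f :
  f \in sE H :\: [set e; erev e] -> erev f \in sE H :\: [set e; erev e].
Proof.
rewrite !inE sE_revE (inj_eq (inv_inj (@erevK G))) => /andP[nf ->].
by rewrite andbT orbC (can2_eq (@erevK G) (@erevK G)).
Qed.

Lemma card_remove_pair H e : e \in sE H ->
  (#|sE H :\: [set e; erev e]| < #|sE H|)%N.
Proof.
move=> eE; apply/proper_card/properP; split; first exact: subsetDl.
by exists e; rewrite // !inE eqxx.
Qed.

Lemma peel_boundary_edge H e :
  e \in sE H -> start e \in sB H -> stop e \in sB H ->
  exists2 H', simple_layerable_extension H' H & (sub_size H' < sub_size H)%N.
Proof.
move=> eE yB xB.
have start_ok f : f \in sE H :\: [set e; erev e] -> start f \in sV H.
  by rewrite inE => /andP[_ /sE_start].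
exists (SubDGraph (@remove_pair_rev H e) start_ok (sI_sub H)).
  apply: (adjoin_boundary_edge (e := e)) => //=; last exact: setD_pairK.
  by rewrite !inE eqxx.
by rewrite ltn_add2l card_remove_pair.
Qed.

Lemma peel_spike H x e : x \in sB H -> out_edges H x = [set e] ->
  stop e \in sI H ->
  exists2 H', simple_layerable_extension H' H & (sub_size H' < sub_size H)%N.
Proof.
move=> xB out_x eI.
have /setP/(_ e) := out_x; rewrite !inE eqxx => /andP[eE /eqP ex].
have [xI xV] : x \notin sI H /\ x \in sV H by move: xB; rewrite inE => /andP.
have start_ok f : f \in sE H :\: [set e; erev e] -> start f \in sV H :\ x.
  rewrite !inE negb_or -andbA => /and3P[nfe _ fE].
  rewrite sE_start // andbT; apply: contraNneq nfe => fx.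
  by move/setP/(_ f): out_x; rewrite !inE fE fx eqxx => <-.
have I_ok : sI H :\ stop e \subset sV H :\ x.
  apply/subsetP=> y; rewrite !inE => /andP[_ yI].
  rewrite (subsetP (sI_sub H)) // andbT.
  by apply: contraNneq xI => <-.
have nex : stop e != x by apply: contraNneq xI => <-.
exists (SubDGraph (@remove_pair_rev H e) start_ok I_ok).
  apply: (adjoin_spike (e := e)); rewrite /= ?ex ?setD1K //.
  - by rewrite !inE eqxx.
  - by rewrite !inE eqxx.
  - by rewrite !inE eqxx nex (subsetP (sI_sub H)).
  - exact: setD_pairK.
rewrite -addSn leq_add //; last exact/ltnW/card_remove_pair.
by rewrite [in leqRHS](cardsD1 x) xV.
Qed.

(** Layers are removed from [H] as long as possible; if this stops before the
    empty subgraph, [irreducible_degenerate] yields a degenerate network. *)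
Lemma layered_of_non_degenerate (F : fieldType) H :
  (exists a b c : F, uniq [:: a; b; c]) ->
  (forall L : network F G, unit_network L -> non_degenerate L) ->
  saturated H -> layered H.
Proof.
move=> F3 ndF; have [n] := ubnP (sub_size H).
elim: n H => // n IHn H; rewrite ltnS => leHn satH.
have peel : (exists2 H', simple_layerable_extension H' H
                & (sub_size H' < sub_size H)%N) -> layered H.
  case=> H' H'H lt_H'; apply: layeredS (H'H); apply: IHn.
    exact: leq_trans lt_H' leHn.
  exact: saturated_ext H'H satH.
case: (pickP [pred x in sB H | #|out_edges H x| == 0%N]) => [x|no_isolated].
  by case/andP=> xB /eqP out0; apply/peel/(peel_isolated xB).
case: (pickP [pred e in sE H | (start e \in sB H) && (stop e \in sB H)])
  => [e|no_edge].
  by case/and3P=> eE yB xB; apply/peel/(peel_boundary_edge eE).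
have B2I e : e \in sE H -> start e \in sB H -> stop e \in sI H.
  move=> eE yB; have := no_edge e; rewrite /= eE yB /= inE.
  by rewrite (sE_start (sE_rev eE)) andbT => /negbFE.
case: (pickP [pred x in sB H | #|out_edges H x| == 1%N]) => [x|no_spike].
  case/andP=> xB /cards1P[e out_x]; apply/peel/(peel_spike xB out_x).
  have := set11 e; rewrite -out_x inE => /andP[eE /eqP ex].
  by apply: B2I; rewrite ?ex.
have deg2 x : x \in sB H -> (1 < #|out_edges H x|)%N.
  move=> xB; move: (no_isolated x) (no_spike x); rewrite /= xB /=.
  by case: #|_| => [|[]].
have [I0|In0] := eqVneq (sI H) set0; last first.
  by have [L /ndF ndL] := irreducible_degenerate F3 satH In0 deg2 B2I.
have V0 : sV H = set0.
  apply/setP=> x; rewrite inE; apply/negP=> xV.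
  have xB : x \in sB H by rewrite inE I0 inE.
  have /ltnW/card_gt0P[e] := deg2 x xB.
  rewrite inE => /andP[eE /eqP ex].
  by have := B2I e eE; rewrite ex => /(_ xB); rewrite I0 inE.
apply: layered0 => //; apply/setP=> e; rewrite inE; apply/negP=> /sE_start.
by rewrite V0 inE.
Qed.

Lemma layerable_of_non_degenerate (F : fieldType) :
  (exists a b c : F, uniq [:: a; b; c]) ->
  (forall L : network F G, unit_network L -> non_degenerate L) ->
  layerable G.
Proof.
move=> F3 ndF.
have /layeredP[n [K [K0 Kstep Kn]]] :=
  layered_of_non_degenerate F3 ndF (saturated_full G).
by exists n, K; split; rewrite ?Kn.
Qed.

End Peel.

(** * Tensor products and free modules *)

Section TensorTheory.
Variables (R : comNzRingType) (M N : lmodType R).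
Implicit Types (a : R) (m : M) (n : N).

Lemma tensDl m m' n : tens (m + m') n = tens m n + tens m' n.
Proof.
by rewrite /tens -linearD; apply/qclass_eqP/span_gen/bilinear_addl.
Qed.

Lemma tensDr m n n' : tens m (n + n') = tens m n + tens m n'.
Proof.
by rewrite /tens -linearD; apply/qclass_eqP/span_gen/bilinear_addr.
Qed.

Lemma tensZl a m n : tens (a *: m) n = a *: tens m n.
Proof.
by rewrite /tens -linearZ; apply/qclass_eqP/span_gen/bilinear_scalel.
Qed.

Lemma tensZr a m n : tens m (a *: n) = a *: tens m n.
Proof.
by rewrite /tens -linearZ; apply/qclass_eqP/span_gen/bilinear_scaler.
Qed.

Lemma tens0r m : tens m (0 : N) = 0.
Proof. by rewrite -(scale0r 0) tensZr scale0r. Qed.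

Lemma tens0l n : tens (0 : M) n = 0.
Proof. by rewrite -(scale0r 0) tensZl scale0r. Qed.

Lemma tens_suml n (I : Type) (s : seq I) (F : I -> M) :
  tens (\sum_(i <- s) F i) n = \sum_(i <- s) tens (F i) n.
Proof.
exact: (big_morph (fun m => tens m n) (fun m m' => tensDl m m' n) (tens0l n)).
Qed.

Lemma tensor_ind (P : tensor M N -> Prop) :
  P 0 -> (forall t u, P t -> P u -> P (t + u)) ->
  (forall m n, P (tens m n)) -> forall t, P t.
Proof.
move=> P0 PD Ptens t; rewrite -[t]qreprK -[qrepr t]freeg_sumE linear_sum.
apply: big_ind => // -[m n] _; rewrite /=.
have -> a (p : M * N) : << a *g p >> = a *: << p >> :> {freeg (M * N) / R}.
  by apply/eqP/freeg_eqP=> q; rewrite coeffZ !coeffU mul1r.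
by rewrite linearZ /= -tensZl.
Qed.

(** The universal property of the tensor product (existence part). *)
Lemma tensor_lift (P : lmodType R) (B : M -> N -> P) :
  (forall n, linear (B^~ n)) -> (forall m, linear (B m)) ->
  exists2 g : tensor M N -> P, linear g & forall m n, g (tens m n) = B m n.
Proof.
move=> Bl Br; pose h (p : M * N) := B p.1 p.2.
have lift_add : {morph fglift h : z w / z + w >-> z + w}.
  move=> z w; have lB := lift_is_additive h.
  have l0 : fglift h 0 = 0 by rewrite -(subrr 0) lB subrr.
  by rewrite -{1}[w]opprK lB -[- w]sub0r lB l0 sub0r opprK.
have lift_sum (I : Type) (s : seq I) (F : I -> {freeg (M * N) / R}) :
    fglift h (\sum_(i <- s) F i) = \sum_(i <- s) fglift h (F i).
  by apply: (big_morph _ lift_add); rewrite -(subrr 0) lift_is_additive subrr.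
have lift_scale a z : fglift h (a *: z) = a *: fglift h z.
  rewrite -[z in RHS]freeg_sumE lift_sum scaler_sumr.
  transitivity (\sum_(p <- dom z) fglift h << a * coeff p z *g p >>).
    exact: lift_sum.
  by apply: eq_bigr => p _; rewrite !liftU scalerA.
have lift_subE z w : fglift h (z - w) = fglift h z - fglift h w.
  exact: lift_is_additive.
have hU m n : fglift h << (m, n) >> = B m n by rewrite liftU scale1r.
have Bscl a m n : B (a *: m) n = a *: B m n by exact: (scalable_linear (Bl n)).
have Badl m m' n : B (m + m') n = B m n + B m' n.
  by have := Bl n 1 m m'; rewrite !scale1r.
have Bscr a m n : B m (a *: n) = a *: B m n by exact: (scalable_linear (Br m)).
have Badr m n n' : B m (n + n') = B m n + B m n'.
  by have := Br m 1 n n'; rewrite !scale1r.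
have lift0 z : in_span (@bilinear_rel R M N) z -> fglift h z = 0.
  elim=> {z} [z []||z w _ z0 _ w0|a z _ z0];
    last by rewrite lift_scale z0 scaler0.
  - by move=> m m' n; rewrite lift_subE lift_add !hU Badl subrr.
  - by move=> m n n'; rewrite lift_subE lift_add !hU Badr subrr.
  - by move=> a m n; rewrite lift_subE lift_scale !hU Bscl subrr.
  - by move=> a m n; rewrite lift_subE lift_scale !hU Bscr subrr.
  - by rewrite -(subrr 0) lift_subE subrr.
  - by rewrite lift_add z0 w0 addr0.
have liftq z : fglift h (qrepr (qclass (@bilinear_rel R M N) z)) = fglift h z.
  apply/eqP; rewrite -subr_eq0 -lift_subE; apply/eqP/lift0/qclass_eqP.
  exact: qreprK.
exists (fun t => fglift h (qrepr t)) => [a t u|m n]; last by rewrite liftq hU.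
rewrite -[t in LHS]qreprK -[u in LHS]qreprK -linearP.
by rewrite (liftq (a *: qrepr t + qrepr u)) lift_add lift_scale.
Qed.

End TensorTheory.

Section Coordinates.
Variables (R : pzRingType) (M : lmodType R) (I : choiceType) (b : I -> M).
Hypothesis b_basis : is_basis b.

(** [k] is the family of coordinates of [m] in the basis [b].  Finite support is
    expressed by letting the sum range over any large enough duplicate-free
    sequence, which makes the coordinates of two vectors easy to combine. *)
Definition coordinates (m : M) (k : I -> R) : Prop :=
  exists s : seq I, forall s', uniq s' -> {subset s <= s'} ->
    m = \sum_(i <- s') k i *: b i.

Lemma coordinates_exist m : exists k, coordinates m k.
Proof.
have [/(_ m)[s [c ->]] _] := b_basis.
(* The sequence [s] may have duplicates, hence the multiplicities. *)
exists (fun i => c i *+ count_mem i s), s => s' uniq_s'.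
elim: s => [|j s IHs] sub_s.
  by rewrite big_nil big1 // => i _; rewrite mulr0n scale0r.
have j_s' : j \in s' by apply: sub_s; rewrite mem_head.
rewrite big_cons IHs => [|i i_s]; last by apply: sub_s; rewrite inE i_s orbT.
under [RHS]eq_bigr => i _ do rewrite /= mulrnDr scalerDl.
rewrite big_split /=; congr (_ + _).
rewrite (bigD1_seq j) //= eqxx mulr1n big1 ?addr0 // => i nij.
by rewrite eq_sym (negPf nij) mulr0n scale0r.
Qed.

Lemma coordinatesP a m m' k k' : coordinates m k -> coordinates m' k' ->
  coordinates (a *: m + m') (fun i => a * k i + k' i).
Proof.
case=> s sP [s' s'P]; exists (s ++ s') => t uniq_t sub_t.
rewrite (sP t) // => [|i i_s]; last by apply: sub_t; rewrite mem_cat i_s.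
rewrite (s'P t) // => [|i i_s]; last by apply: sub_t; rewrite mem_cat i_s orbT.
rewrite scaler_sumr -big_split; apply: eq_bigr => i _ /=.
by rewrite scalerA scalerDl.
Qed.

Lemma coordinates_unique m k k' :
  coordinates m k -> coordinates m k' -> k =1 k'.
Proof.
move=> mk mk' i; have [s sP] := coordinatesP (-1) mk mk'.
have sub_s : {subset s <= undup (i :: s)}.
  by move=> j j_s; rewrite mem_undup inE j_s orbT.
have sum0 := sP _ (undup_uniq _) sub_s.
have [_ b_free] := b_basis.
have := b_free _ _ (undup_uniq _) (etrans (esym sum0) _) i.
rewrite mem_undup mem_head scaleN1r addNr => /(_ erefl isT)/eqP.
by rewrite mulN1r addrC subr_eq0 => /eqP.
Qed.

Lemma coordinate_functions : exists2 k : I -> M -> R,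
  forall i, linear (k i : M -> R^o) & forall m, coordinates m (k^~ m).
Proof.
have [k kP] := choice coordinates_exist.
exists (fun i m => k m i) => // i a m m'.
exact: (coordinates_unique (kP _) (coordinatesP a (kP m) (kP m'))).
Qed.

End Coordinates.

Section FreeFlat.
Variables (R : comNzRingType) (M : lmodType R).

(** A tensor [t] in [tensor M N] is the finite sum of the [tens (b i) (g i t)],
    where [g i] maps [tens m n] to the [i]-th coordinate of [m] times [n], and
    [g] is natural in [N]. *)
Lemma free_flat : free_module M -> flat M.
Proof.
case=> I [b b_basis] N N' f f_inj t u tu.
apply/eqP; rewrite -subr_eq0; set t0 := t - u.
have ft0 : idtens f t0 = 0.
  have := idtens_is_linear (M := M) f (-1) u t; rewrite tu !scaleN1r addNr.
  by rewrite addrC.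
have [k k_lin kP] := coordinate_functions b_basis.
have g_ex (P : lmodType R) : exists g : I -> tensor M P -> P,
    forall i, linear (g i) /\ forall m n, g i (tens m n) = k i m *: n.
  suff ex i : exists g : tensor M P -> P,
      linear g /\ forall m n, g (tens m n) = k i m *: n.
    by have [g gP] := choice ex; exists g.
  suff [g] : exists2 g : tensor M P -> P, linear g &
      forall m n, g (tens m n) = k i m *: n by exists g.
  apply: tensor_lift => [n|m] a x y; first by rewrite k_lin scalerDl scalerA.
  by rewrite scalerDr !scalerA mulrC.
have [g gP] := g_ex N; have [g' g'P] := g_ex N'.
have linD (P : lmodType R) (h : tensor M P -> P) t1 t2 :
    linear h -> h (t1 + t2) = h t1 + h t2.
  by move=> lin_h; have := lin_h 1 t1 t2; rewrite !scale1r.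
have lin0 (P : lmodType R) (h : tensor M P -> P) : linear h -> h 0 = 0.
  by move=> lin_h; have := lin_h (-1) 0 0; rewrite !scaleN1r !addNr.
have fg i v : f (g i v) = g' i (idtens f v).
  have [g_lin gE] := gP i; have [g'_lin g'E] := g'P i.
  have id0 : idtens f (0 : tensor M N) = 0.
    by have := idtens_is_linear (M := M) f (-1) 0 0; rewrite !scaleN1r !addNr.
  elim/tensor_ind: v => [|v w vE wE|m n].
  - by rewrite id0 !lin0 // linear0.
  - have := idtens_is_linear (M := M) f 1 v w; rewrite !scale1r => ->.
    by rewrite !linD // linearD vE wE.
  - by rewrite idtensE gE g'E linearZ.
have [s ->] : exists s, t0 = \sum_(i <- s) tens (b i) (g i t0).
  suff [s sP] : exists s : seq I, forall s', uniq s' -> {subset s <= s'} ->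
      t0 = \sum_(i <- s') tens (b i) (g i t0).
    exists (undup s); apply: sP; first exact: undup_uniq.
    by move=> i; rewrite mem_undup.
  elim/tensor_ind: {tu ft0}t0 => [|v w [s sP] [s' s'P]|m n].
  - exists [::] => s _ _; rewrite big1 // => i _.
    by rewrite lin0 ?tens0r //; case: (gP i).
  - exists (s ++ s') => r uniq_r sub_r.
    rewrite {1}(sP r) // => [|i i_s]; last by apply: sub_r; rewrite mem_cat i_s.
    rewrite {1}(s'P r) // => [|i i_s]; last first.
      by apply: sub_r; rewrite mem_cat i_s orbT.
    rewrite -big_split; apply: eq_bigr => i _ /=.
    by rewrite linD ?tensDr //; case: (gP i).
  - have [s sP] := kP m; exists s => r uniq_r sub_r.
    rewrite {1}(sP r) // tens_suml; apply: eq_bigr => i _.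
    by have [_ ->] := gP i; rewrite tensZl tensZr.
apply/eqP; rewrite big1 // => i _.
suff -> : g i t0 = 0 by rewrite tens0r.
by apply: f_inj; rewrite fg ft0 linear0 lin0 //; case: (g'P i).
Qed.

End FreeFlat.

(** * Flatness and reduction modulo an ideal *)

Section Submodule.
Variables (R : pzRingType) (V : lmodType R) (S : V -> Prop).

Fact spanb_submod_closed : submod_closed (spanb S).
Proof.
split=> [|a v w /spanbP Sv /spanbP Sw]; first exact/spanbP/span0.
by apply/spanbP/spanD => //; apply: spanZ.
Qed.

HB.instance Definition _ := GRing.isSubmodClosed.Build R V (spanb S)
  spanb_submod_closed.

(** The submodule of [V] spanned by [S], as a module. *)
Record spanmod : Type := Spanmod {
  spanmod_val :> V;
  _ : spanmod_val \in spanb S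
}.

HB.instance Definition _ := [isSub for spanmod_val].
HB.instance Definition _ := [Choice of spanmod by <:].
HB.instance Definition _ := [SubChoice_isSubLmodule of spanmod by <:].

End Submodule.

Section FlatIdeal.
Variables (R : comNzRingType) (G : dgraph) (L : network R G).
Variable I : R^o -> Prop.
Hypothesis I0 : I 0.
Hypothesis ID : forall a b, I a -> I b -> I (a + b).
Hypothesis IZ : forall r a, I a -> I (r *: a).
Hypothesis ndL : non_degenerate L.
Hypothesis flatL : flat (Upsilon L).
Notation RV := {ffun vert G -> R^o}.

Lemma in_span_ideal a : a \in spanb I -> I a.
Proof.
by move/spanbP; elim=> {a} [||a b _ Ia _ Ib|r a _ Ia] //; [apply: ID|apply: IZ].
Qed.

(** The functions on the interior vertices with values in the ideal [I]. *)
Definition in_IVint (u : RV) : Prop := in_RVint u /\ forall x, I (u x).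

(** The images under [L] of the functions on the interior vertices, and of those
    with values in [I]. *)
Let Lint (v : RV) : Prop := exists2 u : RV, in_RVint u & v = lap L u.
Let LIint (v : RV) : Prop := exists2 u : RV, in_IVint u & v = lap L u.

Lemma span_LIintP v : in_span LIint v -> LIint v.
Proof.
case/(@in_span_lap_image _ _ L in_IVint)
  => [|u w [u0 uI] [w0 wI]|a u [u0 uI]|w wI ->].
- by split=> [|x]; [apply: in_RVint0 | rewrite ffunE].
- by split=> [|x]; [apply: in_RVintD | rewrite ffunE; apply: ID].
- by split=> [|x]; [apply: in_RVintZ | rewrite ffunE; apply: IZ].
- by exists w; rewrite ?lapE.
Qed.

Lemma span_LintP v : in_span Lint v -> Lint v.
Proof.
case/(in_span_lap_image (@in_RVint0 _ _) (@in_RVintD _ _) (@in_RVintZ _ _))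
  => w wI ->.
by exists w; rewrite ?lapE.
Qed.

(** Multiplication by [a] in [I] maps RV to the functions with values in [I],
    and relations of Upsilon to elements of [LIint]. *)
Lemma qclass_scale_ideal a v w : I a -> in_span Lint (v - w) ->
  qclass LIint (a *: v) = qclass LIint (a *: w).
Proof.
move=> Ia /span_LintP[u uI vw]; apply/qclass_eqP/span_gen.
exists (a *: u); last by rewrite -scalerBr vw !lapE linearZ.
split=> [|x]; first exact: in_RVintZ.
by rewrite ffunE [a *: _]mulrC; apply: IZ.
Qed.

(** This expresses the vanishing of Tor_1(Upsilon, R/I), computed with the
    resolution of Upsilon given by [L] from the functions on interior vertices
    to RV: modulo [I], this map is still injective. *)
Lemma flat_reflects_ideal u : in_RVint u -> (forall x, I (lap_fun L u x)) ->
  forall x, I (u x).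
Proof.
move=> uint LuI.
have memI x : lap_fun L u x \in spanb I by apply/spanbP/span_gen.
pose n x : spanmod I := Spanmod (memI x).
pose q : RV -> Upsilon L := qclass Lint.
(* The element of the product of Upsilon and [I] given by [lap_fun L u]; it is
   zero because its image in the product of Upsilon and R is the class of
   [lap L u]. *)
pose z := \sum_x tens (q (bvec x)) (n x).
have z0 : z = 0.
  have f_inj : injective (val : spanmod I -> R^o) by apply: val_inj.
  apply: (flatL (f := val) f_inj).
  pose val_lin : {linear spanmod I -> R^o} := val.
  pose id_lin := idtens_is_linear (M := Upsilon L) val_lin.
  have id0 : idtens (M := Upsilon L) (val : spanmod I -> R^o) 0 = 0.
    by have := id_lin (-1) 0 0; rewrite !scaleN1r !addNr.
  have idD t t' : idtens (M := Upsilon L) (val : spanmod I -> R^o) (t + t') =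
      idtens val t + idtens val t'.
    by have := id_lin 1 t t'; rewrite !scale1r.
  rewrite id0 /z (big_morph _ idD id0).
  transitivity (tens (q (lap L u)) (1 : R^o)).
    rewrite lapE [in RHS](bvec_decomp (lap_fun L u)) /q linear_sum tens_suml.
    apply: eq_bigr => x _; rewrite idtensE linearZ /= tensZl -tensZr.
    by congr tens; rewrite [RHS]mulr1.
  suff -> : q (lap L u) = 0 by rewrite tens0l.
  have <- : q 0 = 0 by rewrite /q linear0.
  by apply/qclass_eqP; rewrite subr0; apply: span_gen; exists u.
(* The class of [v] and the element [a] of [I] are sent to the class of [a *: v]
   modulo [LIint]; by [qclass_scale_ideal] the representative [v] of the first
   class does not matter. *)
pose B (m : Upsilon L) (a : spanmod I) : quotmod LIint :=
  qclass LIint (val a *: qrepr m).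
have BE (v : RV) (a : spanmod I) : B (q v) a = qclass LIint (val a *: v).
  apply: qclass_scale_ideal; first exact/in_span_ideal/valP.
  by apply/qclass_eqP; rewrite qreprK.
have [a r m m'|m r a a'|g g_lin gE] := tensor_lift (B := B).
- rewrite -[m]qreprK -[m']qreprK -/(q _) -/(q _).
  rewrite -[X in B X](linearP (qclass Lint)).
  by rewrite !BE -linearP scalerDr !scalerA mulrC.
- by rewrite /B linearP scalerDl -scalerA linearP.
have g0 : g 0 = 0 by have := g_lin (-1) 0 0; rewrite !scaleN1r !addNr.
have gD t t' : g (t + t') = g t + g t'.
  by have := g_lin 1 t t'; rewrite !scale1r.
have : qclass LIint (lap_fun L u) = 0.
  rewrite -g0 -z0 /z (big_morph _ gD g0) [in LHS](bvec_decomp (lap_fun L u)).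
  by rewrite linear_sum; apply: eq_bigr => x _; rewrite gE BE.
rewrite -(linear0 (qclass LIint)) => /qclass_eqP; rewrite subr0.
case/span_LIintP=> w [wint wI] Luw.
suff -> : u = w by [].
apply/eqP; rewrite -subr_eq0; apply/eqP/ndL; split=> [x|x].
  by rewrite linearB /= Luw lapE subrr ffunE.
by rewrite inE => xI; rewrite ffun_subE uint ?wint ?subrr.
Qed.

End FlatIdeal.

(** * The generic network *)

Section MapNetwork.
Variables (R S : comPzRingType) (G : dgraph) (f : {rmorphism R -> S}).
Variable L : network R G.

Fact map_network_rev e : f (weight L (erev e)) = f (weight L e).
Proof. by rewrite weight_rev. Qed.

(** The network obtained from [L] by extension of scalars along [f]. *)
Definition map_network : network S G :=
  Network (weight := f \o weight L) (f \o diag L) map_network_rev.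

Lemma lap_fun_map (u : {ffun vert G -> R^o}) x :
  lap_fun map_network ([ffun y => f (u y)] : {ffun vert G -> S^o}) x =
  f (lap_fun L u x).
Proof.
rewrite !lap_funE rmorphD rmorphM ffunE rmorph_sum; congr (_ + _).
by apply: eq_bigr => e _; rewrite !ffunE rmorphM rmorphB.
Qed.

End MapNetwork.

Section LapMatrix.
Variables (R : comPzRingType) (G : dgraph) (L : network R G).

(** The matrix of [L], with the vertices numbered by [enum_val]. *)
Definition lap_mx : 'M[R]_#|vert G| :=
  \matrix_(i, j) lap_fun L (bvec (enum_val j)) (enum_val i).

Lemma lap_mx_mul (u : {ffun vert G -> R^o}) :
  lap_mx *m (\col_i u (enum_val i)) = \col_i lap_fun L u (enum_val i).
Proof.
apply/matrixP=> i j; rewrite !mxE [in RHS](bvec_decomp u) linear_sum sum_ffunE.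
rewrite [RHS](reindex (@enum_val _ (vert G))) /=; last first.
  exact/onW_bij/enum_val_bij.
by apply: eq_bigr => k _; rewrite !mxE linearZ ffun_scaleE mulrC.
Qed.

Lemma det_lap_mx_mul (u : {ffun vert G -> R^o}) x :
  lap_fun L u = 0 -> \det lap_mx * u x = 0.
Proof.
move=> Lu0; have := mul_adj_mx lap_mx.
move/(congr1 (mulmx^~ (\col_i u (enum_val i)))).
rewrite -mulmxA lap_mx_mul Lu0 mul_scalar_mx => /matrixP/(_ (enum_rank x) 0).
rewrite !mxE enum_rankK => <-; rewrite big1 // => k _.
by rewrite !mxE ffunE mulr0.
Qed.

End LapMatrix.

Lemma det_lap_mx_map (R S : comPzRingType) (G : dgraph)
    (f : {rmorphism R -> S}) (L : network R G) :
  \det (lap_mx (map_network f L)) = f (\det (lap_mx L)).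
Proof.
rewrite -det_map_mx; congr (\det _); apply/matrixP=> i j; rewrite !mxE.
rewrite -lap_fun_map; set v := [ffun y => _].
suff -> : v = bvec (enum_val j) by [].
by apply/ffunP=> y; rewrite !ffunE rmorph_nat.
Qed.

Section Generic.
Variables (G : dgraph) (F : fieldType).

Fact Xedge_rev (e : edge G) :
  Xedge F (uedge_of (erev e)) = Xedge F (uedge_of e).
Proof. by rewrite uedge_of_rev. Qed.

(** The generic network [Lstar G F], with scalars in the polynomial ring. *)
Definition poly_network : network (gen_poly G F) G :=
  Network (weight := fun e => Xedge F (uedge_of e)) (@Xvert G F) Xedge_rev.

Section Eval.
Variable L : network F G.

(** The weight of an undirected edge, which is that of either orientation; the
    default value is never taken. *)
Definition uedge_weight (a : uedge G) : F :=
  if [pick e in val a] is Some e then weight L e else 0.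

Lemma uedge_weightE e : uedge_weight (uedge_of e) = weight L e.
Proof.
rewrite /uedge_weight; case: pickP => [f|/(_ e)] /=; rewrite !inE ?eqxx //.
by case/orP=> /eqP->; rewrite ?weight_rev.
Qed.

(** The evaluation of the indeterminates at the coefficients of [L]. *)
Definition specialize : gen_poly G F -> F :=
  meval (fun i => match enum_val i with
                  | inl x => diag L x
                  | inr a => uedge_weight a
                  end).

HB.instance Definition _ := GRing.RMorphism.on specialize.

Lemma specializeC c : specialize c%:MP = c.
Proof. exact: mevalC. Qed.

Lemma specialize_Xvert x : specialize (Xvert F x) = diag L x.
Proof. by rewrite /specialize mevalXU enum_rankK. Qed.

Lemma specialize_Xedge a : specialize (Xedge F a) = uedge_weight a.
Proof. by rewrite /specialize mevalXU enum_rankK. Qed.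

End Eval.

Lemma lap_fun_specialize (L : network F G)
    (u : {ffun vert G -> (gen_poly G F)^o}) x :
  specialize L (lap_fun poly_network u x) =
  lap_fun L ([ffun y => specialize L (u y)] : {ffun vert G -> F^o}) x.
Proof.
rewrite -lap_fun_map !lap_funE /= specialize_Xvert; congr (_ + _).
by apply: eq_bigr => e _; rewrite specialize_Xedge uedge_weightE.
Qed.

(** For the specialization t_x = 1, t_e = 0, the matrix is the identity. *)
Lemma det_poly_network_neq0 : \det (lap_mx poly_network) != 0.
Proof.
pose L1 : network F G := @Network _ _ (fun=> 0) (fun=> 1) (fun=> erefl).
have ev_det : specialize L1 (\det (lap_mx poly_network)) = 1.
  rewrite -det_map_mx [map_mx _ _](_ : _ = 1%:M) ?det1 //.
  apply/matrixP=> i j; rewrite !mxE [LHS]lap_fun_specialize lap_funE /= mul1r.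
  rewrite big1 ?addr0 => [|e _]; last by rewrite mul0r.
  by rewrite !ffunE rmorph_nat (inj_eq enum_val_inj).
apply/eqP=> det0; move/eqP: ev_det.
by rewrite det0 rmorph0 eq_sym oner_eq0.
Qed.

Lemma Lstar_val (u : {ffun vert G -> (Rstar G F)^o}) x :
  val (lap_fun (Lstar G F) u x) =
  lap_fun (map_network (tofrac (R := gen_poly G F)) poly_network)
    ([ffun y => val (u y)] : {ffun vert G -> {fraction gen_poly G F}^o}) x.
Proof.
rewrite !lap_funE rmorphD rmorphM ffunE rmorph_sum; congr (_ + _).
by apply: eq_bigr => e _; rewrite !ffunE rmorphM rmorphB.
Qed.

(** [Lstar G F] is injective, even on functions that do not vanish on the
    boundary, since its determinant is not zero. *)
Lemma Lstar_non_degenerate : non_degenerate (Lstar G F).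
Proof.
move=> u [Lu0 _]; apply/ffunP=> x; rewrite ffunE; apply/val_inj.
set K := map_network (tofrac (R := gen_poly G F)) poly_network.
pose v : {ffun vert G -> {fraction gen_poly G F}^o} := [ffun y => val (u y)].
have Kv0 : lap_fun K v = 0.
  by apply/ffunP=> y; rewrite -Lstar_val Lu0 rmorph0 ffunE.
have /eqP := det_lap_mx_mul x Kv0.
rewrite det_lap_mx_map mulf_eq0 tofrac_eq0 (negPf det_poly_network_neq0) /=.
rewrite ffunE => /eqP->.
exact/esym/(rmorph0 (val : {rmorphism Rstar G F -> _})).
Qed.

(** [flat_reflects_ideal] is applied to the kernel [I] of the specialization
    R^*(G, F) -> F and to a lift of [u] with constant coefficients. *)
Lemma flat_specialization_non_degenerate (L : network F G) :
  flat (Upsilon (Lstar G F)) -> unit_network L -> non_degenerate L.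
Proof.
move=> flatL unitL u [Lu0 uB].
(* The kernel is described through fractions p / s with [specialize L s != 0],
   so that [specialize L] need not be extended to fractions. *)
pose I (z : (Rstar G F)^o) := exists p s : gen_poly G F,
  [/\ specialize L p = 0, specialize L s != 0 & val z * tofrac s = tofrac p].
have ev_mon (m : uedge G -> nat) : specialize L (\prod_a Xedge F a ^+ m a) != 0.
  rewrite rmorph_prod; apply/prodf_neq0 => a _; rewrite rmorphXn expf_neq0 //.
  rewrite /= specialize_Xedge; have /imsetP[e _ ae] := valP a.
  have -> : a = uedge_of e by apply: val_inj.
  rewrite uedge_weightE; have [w ew1] := unitL e.
  by apply: contra_eq_neq ew1 => ->; rewrite mul0r eq_sym oner_neq0.
have I0 : I 0.
  by exists 0, 1; rewrite !rmorph0 rmorph1 oner_neq0 mul0r.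
have ID a b : I a -> I b -> I (a + b).
  case=> p [s [p0 s0 ap]] [q [t [q0 t0 bq]]]; exists (p * t + q * s), (s * t).
  rewrite rmorphD !rmorphM /= p0 q0 !mul0r addr0 mulf_neq0 //; split=> //.
  by rewrite mulrDl mulrA ap [tofrac s * _]mulrC mulrA bq !rmorphD !rmorphM.
have IZ r a : I a -> I (r *: a).
  case=> p [s [p0 s0 ap]]; have /Rstar_predP[q [m rE]] := valP r.
  set mon := \prod_a _ in rE.
  have mon0 : tofrac mon != 0 by exact: prod_Xedge_neq0.
  exists (q * p), (mon * s).
  rewrite !rmorphM /= p0 mulr0 mulf_neq0 ?ev_mon //; split=> //.
  by rewrite rE mulrACA divfK // ap.
pose ut : {ffun vert G -> (gen_poly G F)^o} := [ffun x => (u x)%:MP].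
pose us : {ffun vert G -> (Rstar G F)^o} := [ffun x => Rstar_poly (ut x)].
have evu : [ffun y => specialize L (ut y)] = u.
  by apply/ffunP=> y; rewrite !ffunE specializeC.
have valus : [ffun y => val (us y)] = [ffun y => tofrac (ut y)].
  by apply/ffunP=> y; rewrite !ffunE.
have usI x : I (us x).
  apply: (flat_reflects_ideal I0 ID IZ (@Lstar_non_degenerate) flatL).
    move=> y yI; rewrite !ffunE uB ?inE //; apply: val_inj.
    by rewrite /= !rmorph0.
  move=> y; exists (lap_fun poly_network ut y), 1.
  rewrite rmorph1 oner_neq0 mulr1 lap_fun_specialize evu Lu0; split=> //.
  by rewrite Lstar_val valus lap_fun_map.
apply/ffunP=> x; rewrite ffunE; have [p [s [p0 s0]]] := usI x.
rewrite !ffunE /= -rmorphM => /eqP; rewrite tofrac_eq => /eqP us_p.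
apply/eqP; move/eqP: p0; rewrite -us_p rmorphM /= specializeC mulf_eq0.
by rewrite (negPf s0) orbF.
Qed.

End Generic.

(** * The equivalence *)

Theorem theorem5p16 (G : dgraph) :
  [<-> layerable G;
       forall (R : comPzRingType) (L : network R G),
         unit_network L -> non_degenerate L;
       forall (R : comPzRingType) (L : network R G),
         unit_network L -> non_degenerate L -> free_module (Upsilon L);
       exists F : fieldType,
         (exists a b c : F, uniq [:: a; b; c]) /\
         flat (Upsilon (Lstar G F));
       exists F : fieldType,
         (exists a b c : F, uniq [:: a; b; c]) /\
         (forall L : network F G, unit_network L -> non_degenerate L)].
Proof.
have three : exists a b c : rat, uniq [:: a; b; c] by exists 0, 1, 2%:R.
tfae.
- by move=> layG R L unitL; apply: layerable_non_degenerate.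
- move=> nd R L unitL _; apply: layerable_Upsilon_free => //.
  by apply: (layerable_of_non_degenerate three) => L'; apply: nd.
- move=> free_Upsilon; exists rat; split=> //; apply: free_flat.
  apply: free_Upsilon; first exact: Lstar_unit.
  exact: Lstar_non_degenerate.
- case=> F [F3 flat_Upsilon]; exists F; split=> // L.
  exact: flat_specialization_non_degenerate.
- by case=> F [F3 ndF]; apply: layerable_of_non_degenerate ndF.
Qed.
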